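(* Let $n\in\mathbb{N}$, let $V$ be an $n$-dimensional vector space over $K=\mathbb{F}_q$ or $K=\mathbb{C}$, and let $w\in\mathrm{GL}(V)\ast\mathbf{F}_r$ be a reduced word (with respect to $\mathrm{SL}(V)$) of length $l\geq 2$. Then the word image $w(\mathrm{SL}(V)^r)=\{w(h_1,\dots,h_r): h_1,\dots,h_r\in\mathrm{SL}(V)\}$ has diameter at least $$\mathrm{diam}(w(\mathrm{SL}(V)^r))\geq\frac{|w|_{\rm crit}}{l}-1$$ in the projective rank seminorm.
   Context: $\mathbf{F}_r=\langle x_1,\ldots,x_r\rangle$ is the free group of rank $r$. For a group $G$, $w\in G\ast\mathbf{F}_r$ and $h_1,\dots,h_r\in G$, $w(h_1,\dots,h_r)$ is the image of $w$ under the homomorphism $G\ast\mathbf{F}_r\to G$ that is the identity on $G$ and maps $x_i\mapsto h_i$. Put $G=\mathrm{GL}(V)$ and write $w=c_0x_{\iota(1)}^{\varepsilon(1)}c_1\cdots c_{l-1}x_{\iota(l)}^{\varepsilon(l)}c_l$ with $c_j\in G$, $\iota(j)\in\{1,\dots,r\}$, $\varepsilon(j)\in\{\pm1\}$; the length of $w$ is $l$. Define subsets of $\{1,\dots,l-1\}$: $J_0(w)=\{j:\iota(j)\neq\iota(j+1)\}$, $J_+(w)=\{j:\iota(j)=\iota(j+1),\ \varepsilon(j)=\varepsilon(j+1)\}$, $J_-(w)=\{j:\iota(j)=\iota(j+1),\ \varepsilon(j)=-\varepsilon(j+1)\}$. The word is reduced with respect to $H\leq G$ (here $H=\mathrm{SL}(V)$,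 the group whose elements are plugged in) if $c_j\notin\mathbf{C}_G(H)\setminus\{1\}$ for $j\in J_0(w)\cup J_+(w)$ and $c_j\notin\mathbf{C}_G(H)$ for $j\in J_-(w)$, where $\mathbf{C}_G(H)$ is the centralizer of $H$ in $G$. The projective rank seminorm on $\mathrm{GL}(V)$ is $|g|=\min_{\lambda\in K^\times}\mathrm{rk}(g-\lambda 1_V)$, with pseudometric $\mathrm{dist}(g,h)=|g^{-1}h|$; all diameters are taken in this pseudometric. The critical length is $|w|_{\rm crit}=\min\left(\{\mathrm{diam}(\mathrm{GL}(V))\}\cup\{|c_j|: j\in J_-(w)\}\right)$. *)

(* Defs.v *)
From HB Require Import structures.
From mathcomp Require Import all_boot all_order all_algebra.
From mathcomp Require Import all_classical reals.
From mathcomp Require Import complex.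

Set Implicit Arguments.
Unset Strict Implicit.
Unset Printing Implicit Defensive.

Import Order.TTheory GRing.Theory Num.Theory.
Local Open Scope classical_set_scope.
Local Open Scope ring_scope.

(* [realType] is the type of complete archimedean ordered fields, so [complex R]
   is the field of complex numbers. *)
Variant finite_or_complex : fieldType -> Prop :=
| FiniteScalars (F : finFieldType) : finite_or_complex F
| ComplexScalars (R : realType) : finite_or_complex (complex R).

Section LinearGroups.
Variables (K : fieldType) (n : nat).
Implicit Types (g h : 'M[K]_n) (G H S : set 'M[K]_n).

(* [V] is [K^n]; [n = 0] is allowed. *)
Definition GL : set 'M[K]_n := [set g | g \in unitmx].
Definition SL : set 'M[K]_n := [set g | \det g = 1].

Definition centralizer G H : set 'M[K]_n :=
  [set g | G g /\ forall h, H h -> g *m h = h *m g].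

(* The infimum, in [nat], of a nonempty set, hence a minimum: see [prankP]. *)
Definition prank g : nat :=
  infimum 0%N [set \rank (g - lam%:M) | lam in [set lam : K | lam != 0]].

Definition pdist g h : nat := prank (invmx g *m h).

(* The supremum, in [nat], of a set bounded by [n]: see [pdiamP]. *)
Definition pdiam S : nat :=
  supremum 0%N [set d | exists g h, [/\ S g, S h & d = pdist g h]].

Lemma prankP g :
  (exists2 lam : K, lam != 0 & prank g = \rank (g - lam%:M)) /\
  (forall lam : K, lam != 0 -> (prank g <= \rank (g - lam%:M)%R)%N).
Proof.
rewrite /prank; set A := [set _ | _ in _].
have exA : exists k, `[< A k >].
  exists (\rank (g - 1%:M)); apply/asboolP.
  by exists 1 => //=; rewrite oner_neq0.
have [m /asboolP Am minm] := ex_minnP exA.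
have infm : infimums A m.
  split=> [k Ak|k]; last exact.
  by rewrite leEnat; apply: minm; apply/asboolP.
have -> : infimum 0%N A = m.
  rewrite /infimum; case: ifPn => [/eqP A0|_]; first by rewrite A0 in Am.
  case: xgetP => [y _ [ly uy]|/(_ m) //].
  apply/eqP; rewrite eq_le (ly m Am) /=.
  by apply: uy; case: infm.
split=> [|lam lam0]; first by case: Am => lam lam0 <-; exists lam.
by apply: minm; apply/asboolP; exists lam.
Qed.

Lemma pdiamP S : S !=set0 ->
  (exists g h, [/\ S g, S h & pdiam S = pdist g h]) /\
  (forall g h, S g -> S h -> (pdist g h <= pdiam S)%N).
Proof.
case=> s Ss; rewrite /pdiam; set A := [set _ | _].
have As : exists k, `[< A k >].
  by exists (pdist s s); apply/asboolP; exists s, s.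
have bA k : `[< A k >] -> (k <= n)%N.
  move=> /asboolP[g [h [_ _ ->]]].
  have [[lam _ E] _] := prankP (invmx g *m h).
  by rewrite /pdist E; exact: rank_leq_row.
have [m /asboolP Am maxm] := ex_maxnP As bA.
have ubm : ubound A m by move=> k Ak; apply: maxm; apply/asboolP.
have -> : supremum 0%N A = m.
  rewrite /supremum; case: ifPn => [/eqP A0|_]; first by rewrite A0 in Am.
  case: xgetP => [y _ [uy ly]|/(_ m) []].
    by apply/eqP; rewrite eq_le (uy m Am) andbT; apply: ly.
  by split=> // k; exact.
split=> [|g h Sg Sh]; first exact: Am.
by apply: ubm; exists g, h.
Qed.

(* The expression  c_0 x_{i(1)}^{e(1)} c_1 ... x_{i(l)}^{e(l)} c_l,  indexed as
   written: only [wcoef j] for [0 <= j <= l] and [wvar j], [wsgn j] for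
   [1 <= j <= l] are meaningful. [wsgn j = true] stands for exponent 1 and
   [false] for exponent -1. The variables are numbered from 0. *)
Record word (r l : nat) := Word {
  wcoef : nat -> 'M[K]_n;
  wvar : nat -> 'I_r;
  wsgn : nat -> bool;
  wcoef_GL : forall j, (j <= l)%N -> GL (wcoef j)
}.

Section Words.
Variables (r l : nat).
Implicit Types w : word r l.

Definition J0 w : set nat :=
  [set j | (0 < j < l)%N /\ wvar w j != wvar w j.+1].
Definition Jplus w : set nat :=
  [set j | [/\ (0 < j < l)%N, wvar w j = wvar w j.+1 & wsgn w j = wsgn w j.+1]].
Definition Jminus w : set nat :=
  [set j | [/\ (0 < j < l)%N, wvar w j = wvar w j.+1
             & wsgn w j = ~~ wsgn w j.+1]].

Definition reduced H w : Prop :=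
  (forall j, (J0 w `|` Jplus w) j ->
     ~ (centralizer GL H `\ 1%:M) (wcoef w j)) /\
  (forall j, Jminus w j -> ~ centralizer GL H (wcoef w j)).

Definition weval w (hs : 'I_r -> 'M[K]_n) : 'M[K]_n :=
  wcoef w 0%N *m
  \prod_(1 <= j < l.+1)
    ((if wsgn w j then hs (wvar w j) else invmx (hs (wvar w j))) *m wcoef w j).

Definition word_image H w : set 'M[K]_n :=
  weval w @` [set hs | forall i, H (hs i)].

Definition crit_length w : nat :=
  infimum 0%N ([set pdiam GL] `|` [set prank (wcoef w j) | j in Jminus w]).

End Words.
End LinearGroups.

Arguments GL {K n}.
Arguments SL {K n}.

(* Main.v *)
(* Matrices act on row vectors from the right, so a word carries a vector through
   [c_0], [x_1], [c_1], ... in reading order. Let [k] be the largest integer with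
   [k * l < |w|_crit]. We choose [k] starting vectors and build their trajectories
   through the word letter by letter, each letter prescribing one more value of
   one of the unknown matrices. A new value [b] must avoid the range of the partial
   map at hand, and [b *m c_j] the domain of the next one: two proper subspaces.
   Only at [j] in [J_-] is that domain enlarged by [b] itself; then [b] and
   [b *m c_j] have to be independent modulo a subspace of dimension less than
   [|c_j|], which is possible as otherwise [c_j] would be scalar modulo it.
   At most [k * l < n] values are prescribed, so partial maps extend to [SL]. The
   endpoints are kept independent of each other and of the starting vectors,
   whence every [w(1)^-1 w(hs) - lam] has rank at least [k]. *)
Require Import Defs.
From mathcomp Require Import all_boot all_order all_algebra.
From mathcomp Require Import all_classical reals.
From mathcomp Require Import ring.
Import Order.TTheory GRing.Theory Num.Theory.
Local Open Scope ring_scope.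

Set Implicit Arguments.
Unset Strict Implicit.
Unset Printing Implicit Defensive.

(** * Row vectors: independence, avoidance of subspaces, extension of partial maps *)

Section RowVectors.
Variables (K : fieldType) (n : nat).
Implicit Types (p q u v : 'rV[K]_n) (U : {vspace 'rV[K]_n}) (X : seq 'rV[K]_n).

Lemma free_row_free m (X : m.-tuple 'rV[K]_n) :
  free X = row_free (\matrix_(i < m) X`_i).
Proof.
apply/freeP/idP => [freeX | freeA k k0 i].
  apply: inj_row_free => a; rewrite mulmx_sum_row => a0.
  apply/rowP => i; rewrite mxE; apply: (freeX (a 0)).
  by rewrite -[RHS]a0; apply: eq_bigr => j _; rewrite rowK.
have : (\row_j k j) *m (\matrix_(i < m) X`_i) = 0 *m (\matrix_(i < m) X`_i).
  by rewrite mul0mx mulmx_sum_row -[RHS]k0; apply: eq_bigr => j _; rewrite rowK mxE.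
by move/(row_free_inj freeA)/rowP/(_ i); rewrite !mxE.
Qed.

Lemma rank_ge_free m (M : 'M[K]_(m, n)) X :
  free X -> (forall p, p \in X -> (p <= M)%MS) -> (size X <= \rank M)%N.
Proof.
move=> freeX XM; have := free_row_free (in_tuple X).
rewrite freeX => /esym/eqP <-; apply: mxrankS; apply/row_subP => i.
by rewrite rowK; apply: XM; apply: mem_nth.
Qed.

Lemma rank_le_dim m (M : 'M[K]_(m, n)) U :
  (forall a, a *m M \in U) -> (\rank M <= \dim U)%N.
Proof.
move=> MU; pose X := [tuple row i (row_base M) | i < \rank M].
have freeX : free X.
  rewrite free_row_free (_ : \matrix_i _ = row_base M) ?row_base_free //.
  by apply/row_matrixP => i; rewrite rowK -tnth_nth tnth_mktuple.
rewrite -[X in (X <= _)%N](size_tuple X) -(eqP freeX); apply: dimvS.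
apply/span_subvP => p /tnthP[i ->]; rewrite tnth_mktuple.
have /submxP[a ->] : (row i (row_base M) <= M)%MS.
  by rewrite (submx_trans (row_sub _ _)) ?eq_row_base.
exact: MU.
Qed.

Lemma notin_vspace U : (\dim U < n)%N -> exists p, p \notin U.
Proof.
move=> Un; have /subvPn[p _ pU] : ~~ (fullv <= U)%VS; last by exists p.
by apply/negP => /dimvS; rewrite dimvf dim_matrix mul1r leqNgt Un.
Qed.

Lemma notin_span X : (size X < n)%N -> exists p, p \notin <<X>>%VS.
Proof. by move=> Xn; apply/notin_vspace/(leq_ltn_trans (dim_span X)). Qed.

(** No vector space is the union of two proper subspaces, here the span of [X] and the preimage
    under [c] of the span of [Y]. *)
Lemma notin_two_spans (c : 'M[K]_n) X Y :
  c \in unitmx -> (size X < n)%N -> (size Y < n)%N ->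
  exists2 p, p \notin <<X>>%VS & p *m c \notin <<Y>>%VS.
Proof.
move=> uc /notin_span[p pX] /notin_span[q qY].
have [pcY|] := boolP (p *m c \in <<Y>>%VS); last by exists p.
have [qX|qX] := boolP (q *m invmx c \in <<X>>%VS); last first.
  by exists (q *m invmx c); rewrite ?mulmxKV.
exists (p + q *m invmx c); first by rewrite rpredDr.
by rewrite mulmxDl mulmxKV // rpredDl.
Qed.

(* The failure of the conclusion makes every vector outside [U] an eigenvector of
   [c] modulo [U]; the eigenvalue is constant as the codimension is at least 2, so
   [c - lam] has image in [U]. *)
Lemma notin_line_add (c : 'M[K]_n) U :
  c \in unitmx -> (\dim U + 1 < n)%N -> (\dim U < prank c)%N ->
  exists2 p, p \notin U & p *m c \notin (<[p]> + U)%VS.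
Proof.
move=> uc Un Uc; apply: contrapT => none.
have eigen p : p \notin U -> exists lam, p *m c - lam *: p \in U.
  move=> pU; have : p *m c \in (<[p]> + U)%VS.
    by apply: contrapT => /negP pc; apply: none; exists p.
  case/memv_addP=> _ /vlineP[lam ->] [u uU ->].
  by exists lam; rewrite addrAC subrr add0r.
(* The eigenvalue [m] of [p + q] puts [(m - lp) *: p + (m - lq) *: q] in [U]; as [p] and [q] are
   independent modulo [U], both coefficients vanish. *)
have eigen_eq p q lp lq : p \notin U -> q \notin (<[p]> + U)%VS ->
    p *m c - lp *: p \in U -> q *m c - lq *: q \in U -> lp = lq.
  move=> pU qpU pl ql.
  have pV : p \in (<[p]> + U)%VS by exact: (subvP (addvSl _ _)) (memv_line p).
  have pqU : p + q \notin U.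
    apply: contra qpU => pqU; rewrite -(rpredDl _ pV).
    exact: (subvP (addvSr _ _)) pqU.
  have [m ml] := eigen _ pqU.
  have comb : (m - lp) *: p + (m - lq) *: q \in U.
    have -> : (m - lp) *: p + (m - lq) *: q =
      (p *m c - lp *: p) + (q *m c - lq *: q) - ((p + q) *m c - m *: (p + q)).
      rewrite mulmxDl; move: (p *m c) (q *m c) => pc qc.
      by apply/rowP => i; rewrite !mxE; ring.
    by rewrite rpredB // rpredD.
  have mq : m = lq.
    apply/eqP; rewrite -subr_eq0; apply: contraNT qpU => mq0.
    rewrite -[q]scale1r -(mulVf mq0) -scalerA memvZ //.
    rewrite -(rpredDl _ (memvZ (m - lp) pV)).
    exact: (subvP (addvSr _ _)) comb.
  rewrite mq subrr scale0r addr0 in comb.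
  apply/esym/eqP; rewrite -subr_eq0; apply: contraNT pU => m0.
  by rewrite -[p]scale1r -(mulVf m0) -scalerA memvZ.
have [e eU] : exists e, e \notin U.
  by apply: notin_vspace; apply: leq_trans Un; rewrite addn1.
have [l0 el] := eigen _ eU.
have [f feU] : exists f, f \notin (<[e]> + U)%VS.
  apply: notin_vspace; apply: leq_ltn_trans Un; rewrite addnC.
  apply: leq_trans (dimv_add_leqif _ _) _.
  by rewrite leq_add2r dim_vline leq_b1.
have fU : f \notin U by apply: contra feU => fU; exact: (subvP (addvSr _ _)) fU.
have [lf fl] := eigen _ fU.
have l0_lf := eigen_eq _ _ _ _ eU feU el fl.
have eigen_l0 p : p \notin U -> p *m c - l0 *: p \in U.
  move=> pU; have [lp pl] := eigen _ pU.
  suff -> : l0 = lp by [].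
  (* Modulo [U], [p] is independent of [e] or, when it lies in [<[e]> + U], of [f]. *)
  have [peU|peU] := boolP (p \in (<[e]> + U)%VS); last exact: eigen_eq eU peU el pl.
  rewrite l0_lf; apply/esym/(eigen_eq p f) => //; apply: contra feU => fpU.
  by apply: (subvP _ _ fpU); rewrite subv_add addvSr andbT -memvE.
have cU p : p *m (c - l0%:M) \in U.
  rewrite mulmxBr mul_mx_scalar.
  have [pU|] := boolP (p \in U); last exact: eigen_l0.
  have := eigen_l0 (p + e); rewrite rpredDl // => /(_ eU).
  by rewrite mulmxDl scalerDr opprD addrACA rpredDr.
have := rank_le_dim cU; rewrite leqNgt => /negP; apply.
(* [prank] minimises over nonzero scalars only; for [l0 = 0] the image of the invertible [c] would
   lie in [U], of dimension below [n]. *)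
have [l0_eq0|l0_eq0] := eqVneq l0 0.
  by rewrite l0_eq0 raddf0 subr0 mxrank_unit // (leq_trans _ Un) // addn1.
by apply: leq_trans Uc _; have [_] := prankP c; apply.
Qed.

(** Pairs are added until both families are bases; [size s < n] leaves at least one of them to
    choice. *)
Lemma SL_extension (s : seq ('rV[K]_n * 'rV[K]_n)) :
  free (unzip1 s) -> free (unzip2 s) -> (size s < n)%N ->
  exists2 h, SL h & {in s, forall x, x.1 *m h = x.2}.
Proof.
move=> free1 free2 /subnKC; move: (n - _)%N => d.
elim: d => [|d IHd] in s free1 free2 *; rewrite addSn => sn.
all: have s_n : (size s < n)%N by apply: leq_trans (eq_leq sn); rewrite ltnS leq_addr.
all: have [a a_s] : exists a, a \notin <<unzip1 s>>%VS.
1,3: by apply: notin_span; rewrite size_map.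
all: have [b b_s] : exists b, b \notin <<unzip2 s>>%VS.
1,3: by apply: notin_span; rewrite size_map.
all: have freea : free (unzip1 ((a, b) :: s)) by rewrite /= free_cons a_s.
all: have freeb : free (unzip2 ((a, b) :: s)) by rewrite /= free_cons b_s.
  rewrite addn0 in sn.
  have size1 : size (unzip1 ((a, b) :: s)) == n by rewrite size_map; apply/eqP.
  have size2 : size (unzip2 ((a, b) :: s)) == n by rewrite size_map; apply/eqP.
  have uA := free_row_free (Tuple size1); have uB := free_row_free (Tuple size2).
  rewrite freea row_free_unit in uA; rewrite freeb row_free_unit in uB.
  set A := \matrix_i _ in uA; set B := \matrix_i _ in uB.
  (* Rescaling the freely chosen [b] corrects the determinant. *)
  pose delta := \det A / \det B.
  pose D : 'M[K]_n := diag_mx (\row_i if val i == 0%N then delta else 1).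
  have detD : \det D = delta.
    have n_gt0 : (0 < n)%N by apply: leq_ltn_trans s_n.
    rewrite det_diag (bigD1 (Ordinal n_gt0)) //= mxE /= big1 ?mulr1 // => i.
    by rewrite mxE -val_eqE /= => /negPf->.
  exists (invmx A *m (D *m B)).
    rewrite /SL /= !det_mulmx det_inv detD /delta divfK; last by rewrite -unitfE -unitmxE.
    by rewrite mulVf // -unitfE -unitmxE.
  move=> p /(nthP (0, 0))[i i_s <-].
  have i_n : (i.+1 < n)%N by apply: leq_trans (eq_leq sn).
  have rowA : row (Ordinal i_n) A = (nth (0, 0) s i).1.
    by rewrite rowK /= (nth_map (0, 0)).
  have rowB : row (Ordinal i_n) B = (nth (0, 0) s i).2.
    by rewrite rowK /= (nth_map (0, 0)).
  by rewrite -rowA -row_mul mulKVmx // row_mul row_diag_mx mxE /= scale1r -rowE.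
have [|h SLh hs] := IHd _ freea freeb; first by rewrite -[RHS]sn /= addnS.
by exists h => // p ps; apply: hs; rewrite inE ps orbT.
Qed.

End RowVectors.

(** * Partial injections and the prescription of one letter *)

Section PartialMaps.
Variables (K : fieldType) (n r : nat).
Implicit Types (a b : 'rV[K]_n) (i : 'I_r) (e : bool) (hs : 'I_r -> 'M[K]_n).

(* A partial linear map [x_i] is the list of pairs (vector, image) prescribed for
   it; [ends true] is its domain and [ends false] its range, so that negating the
   sign amounts to inverting the map. *)
Definition ends e (s : seq ('rV[K]_n * 'rV[K]_n)) :=
  [seq if e then p.1 else p.2 | p <- s].

Implicit Types s : 'I_r -> seq ('rV[K]_n * 'rV[K]_n).

Definition partial_injections N s :=
  forall i, (size (s i) <= N)%N /\ forall e, free (ends e (s i)).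

Definition solves hs s := forall i, {in s i, forall p, p.1 *m hs i = p.2}.

Definition letter hs i e := if e then hs i else invmx (hs i).

(** Prescribes that [x_i], or its inverse if [e] is [false], sends [a] to [b]. *)
Definition link s i e a b : 'I_r -> seq ('rV[K]_n * 'rV[K]_n) :=
  fun k => if k == i then (if e then (a, b) else (b, a)) :: s k else s k.

Lemma ends_link s i e a b k e' :
  ends e' (link s i e a b k) =
  if k == i then (if e' == e then a else b) :: ends e' (s k) else ends e' (s k).
Proof. by rewrite /link; case: eqP => // _; case: e e' => -[]. Qed.

Lemma partial_injections_link N s i e a b :
  partial_injections N s ->
  a \notin <<ends e (s i)>>%VS -> b \notin <<ends (~~ e) (s i)>>%VS ->
  partial_injections N.+1 (link s i e a b).
Proof.
move=> sN ea eb k; have [sizek freek] := sN k; split=> [|e'].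
  by rewrite /link; case: eqP => // _; apply: leqW.
rewrite ends_link; case: eqP => // ->; rewrite free_cons (sN i).2 andbT.
by case: eqP => [-> // | /eqP]; rewrite negb_eqb => /addbP/(canRL negbK) ->.
Qed.

Lemma solves_link hs s i e a b :
  hs i \in unitmx -> solves hs (link s i e a b) ->
  solves hs s /\ a *m letter hs i e = b.
Proof.
move=> ui hsl; split=> [k p ps|].
  by apply: hsl; rewrite /link; case: eqP => // _; rewrite inE ps orbT.
have := hsl i; rewrite /link eqxx => /(_ _ (mem_head _ _)).
by case: e {hsl} => //= <-; rewrite mulmxK.
Qed.

Lemma SL_solution N s : partial_injections N s -> (N < n)%N ->
  exists2 hs, (forall i, SL (hs i)) & solves hs s.
Proof.
move=> sN Nn.
have /fin_all_exists[hs hsP] i :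
    exists h : 'M[K]_n, SL h /\ {in s i, forall p, p.1 *m h = p.2}.
  have [size_s free_s] := sN i.
  have [|h] := SL_extension (free_s true) (free_s false); last by exists h.
  exact: leq_ltn_trans Nn.
by exists hs => i; have [] := hsP i.
Qed.

End PartialMaps.

(** * Trajectories of vectors through a word *)

Section Words.
Variables (K : fieldType) (n r l : nat) (w : word K n r l).
Implicit Types (s : 'I_r -> seq ('rV[K]_n * 'rV[K]_n)) (hs : 'I_r -> 'M[K]_n).

(** What a vector arriving at letter [j], past the coefficient before it, has yet to pass
    through. *)
Definition suffix_eval hs j : 'M[K]_n :=
  \prod_(j <= t < l.+1) (letter hs (wvar w t) (wsgn w t) *m wcoef w t).

Variable L : nat.
Hypotheses (Ln : (L < n)%N)
  (Lprank : forall j, Jminus w j -> (L < prank (wcoef w j))%N).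

(** Induction on the number [m] of letters after the [j]-th, under the invariant that the arriving
    vector [a] lies outside the domain of its letter. At the last letter the span of [X] replaces
    the next domain. *)
Lemma extend_trajectory m j N s (a : 'rV[K]_n) (X : seq 'rV[K]_n) :
  (0 < j)%N -> (j + m)%N = l -> (N + m < L)%N -> (size X < n)%N ->
  partial_injections N s ->
  a \notin <<ends (wsgn w j) (s (wvar w j))>>%VS ->
  exists s' u, [/\ partial_injections (N + m.+1) s', u \notin <<X>>%VS &
    forall hs, (forall i, hs i \in unitmx) -> solves hs s' ->
      solves hs s /\ a *m suffix_eval hs j = u].
Proof.
elim: m => [|m IHm] in j N s a * => j_gt0 jl NL Xn sN a_s.
  have [size_s free_s] := sN (wvar w j).
  rewrite addn0 in jl; rewrite addn0 in NL; have cj := wcoef_GL w (eq_leq jl).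
  have size_end e : (size (ends e (s (wvar w j))) < n)%N.
    by rewrite size_map; exact: leq_ltn_trans size_s (ltn_trans NL Ln).
  have [b b_s bX] := notin_two_spans cj (size_end (~~ wsgn w j)) Xn.
  exists (link s (wvar w j) (wsgn w j) a b), (b *m wcoef w j); split=> //.
    by rewrite addn1; apply: partial_injections_link.
  move=> hs uhs /(solves_link (uhs _))[hs_s <-]; split=> //.
  by rewrite /suffix_eval jl big_nat1 mulmxA.
have jl' : (j < l)%N by rewrite -jl addnS ltnS leq_addr.
have cj := wcoef_GL w (ltnW jl').
have [size_s free_s] := sN (wvar w j).
have size_end k e : (size (ends e (s k)) <= N)%N by rewrite size_map; case: (sN k).
have NmL : (N.+2 <= L)%N by rewrite (leq_trans _ NL) // addnS !ltnS leq_addr.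
(* The next domain is unchanged if the variable changes, gains [a] if the letter repeats, and gains
   [b] if it is inverted. *)
have [b b_s b_next] : exists2 b, b \notin <<ends (~~ wsgn w j) (s (wvar w j))>>%VS &
  b *m wcoef w j \notin <<ends (wsgn w j.+1)
    (link s (wvar w j) (wsgn w j) a b (wvar w j.+1))>>%VS.
  have [sv|nv] := eqVneq (wvar w j) (wvar w j.+1); last first.
    have [||b b1 b2] := notin_two_spans (X := ends (~~ wsgn w j) (s (wvar w j)))
      (Y := ends (wsgn w j.+1) (s (wvar w j.+1))) cj.
    - by rewrite (leq_ltn_trans (size_end _ _)) // ltnW // (leq_trans NmL) // ltnW.
    - by rewrite (leq_ltn_trans (size_end _ _)) // ltnW // (leq_trans NmL) // ltnW.
    by exists b => //; rewrite ends_link eq_sym (negPf nv).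
  have [sg|sg] := eqVneq (wsgn w j.+1) (wsgn w j).
    have [||b b1 b2] := notin_two_spans (X := ends (~~ wsgn w j) (s (wvar w j)))
      (Y := a :: ends (wsgn w j.+1) (s (wvar w j.+1))) cj.
    - by rewrite (leq_ltn_trans (size_end _ _)) // ltnW // (leq_trans NmL) // ltnW.
    - by rewrite /= (leq_ltn_trans (size_end _ _ : _.+1 <= N.+1)%N) // (leq_trans NmL) // ltnW.
    by exists b => //; rewrite ends_link sv eqxx sg eqxx -sg.
  have sg' : wsgn w j = ~~ wsgn w j.+1 by case: (wsgn w j) (wsgn w j.+1) sg => -[].
  have jm : Jminus w j by split=> //; rewrite j_gt0.
  (* Here the range to avoid and the old domain of the next letter coincide. *)
  have dimU : (\dim <<ends (wsgn w j.+1) (s (wvar w j.+1))>> <= N)%N.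
    exact: leq_trans (dim_span _) (size_end _ _).
  have [||b b1 b2] := notin_line_add
    (U := <<ends (wsgn w j.+1) (s (wvar w j.+1))>>%VS) cj.
  - by rewrite addn1; apply: leq_trans (ltnW Ln); apply: leq_trans NmL.
  - by apply: leq_ltn_trans dimU (leq_trans (ltnW NmL) (ltnW (Lprank jm))).
  exists b; first by rewrite sg' negbK sv.
  by rewrite ends_link sv eqxx (negPf sg) span_cons.
have sN1 := partial_injections_link sN a_s b_s.
have [||||s' [u [s'N uX s'P]]] // := IHm j.+1 N.+1 _ _ _ _ _ _ sN1 b_next.
- by rewrite addSnnS.
- by rewrite addSnnS.
exists s', u; split=> //; first by rewrite -addSnnS.
move=> hs uhs /(s'P _ uhs)[/(solves_link (uhs _))[hs_s ab] bu]; split=> //.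
by rewrite -bu -ab /suffix_eval big_ltn ?ltnS 1?ltnW // -mulmxE !mulmxA.
Qed.

Lemma wevalE hs : weval w hs = wcoef w 0 *m suffix_eval hs 1.
Proof. by []. Qed.

Lemma weval_unit hs : (forall i, hs i \in unitmx) -> weval w hs \in unitmx.
Proof.
move=> uhs; rewrite /weval unitmx_mul (wcoef_GL w) //= big_nat.
apply: (big_ind (fun A : 'M[K]_n => A \in unitmx)) => [|A B uA uB|j /andP[_ jl]].
- exact: unitmx1.
- by rewrite -mulmxE unitmx_mul uA.
rewrite unitmx_mul (wcoef_GL w) // andbT.
by case: ifP => _; rewrite ?unitmx_inv.
Qed.

(** Each endpoint precedes its start, so that freeness asks it, chosen last, to avoid the start and
    all earlier trajectories. *)
Definition flatten_pairs (z : seq ('rV[K]_n * 'rV[K]_n)) :=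
  flatten [seq [:: p.2; p.1] | p <- z].

Lemma size_flatten_pairs z : size (flatten_pairs z) = (size z).*2.
Proof. by elim: z => //= p z ->; rewrite doubleS. Qed.

(** If [u - lam *: v] were in the span of the later differences, [u] would be in the span of [v] and
    the later pairs. *)
Lemma free_sub_scale lam z : free (flatten_pairs z) ->
  free [seq p.2 - lam *: p.1 | p <- z].
Proof.
elim: z => //= -[v u] z IHz /=; rewrite !free_cons => /and3P[u_vz _ free_z].
rewrite IHz // andbT; apply: contra u_vz => u_lam.
rewrite -[u](subrK (lam *: v)) span_cons addrC memv_add //.
  by rewrite memvZ ?memv_line.
apply: (subvP _ _ u_lam); apply/span_subvP => _ /mapP[p pz ->].
rewrite rpredB ?rpredZ //; apply: memv_span; apply/flattenP;
  by exists [:: p.2; p.1]; rewrite ?inE ?eqxx ?orbT //; apply: map_f.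
Qed.

Lemma independent_trajectories (g : 'M[K]_n) t :
  g \in unitmx -> (2 <= l)%N -> (t * l <= L)%N ->
  exists s z, [/\ partial_injections (t * l) s, size z = t,
    free (flatten_pairs z) &
    forall hs, (forall i, hs i \in unitmx) -> solves hs s ->
      {in z, forall p, p.1 *m (g *m weval w hs) = p.2}].
Proof.
move=> ug l2; elim: t => [_|t IHt tL].
  exists (fun=> [::]), [::]; split=> //; last by rewrite /flatten_pairs /= nil_free.
  by move=> i; split=> // e; rewrite nil_free.
rewrite mulSn in tL.
have [|s [z [sN sizez freez sz]]] := IHt; first by apply: leq_trans tL; rewrite leq_addl.
have ugc : g *m wcoef w 0 \in unitmx by rewrite unitmx_mul ug (wcoef_GL w).
(* [2 <= l] keeps the starts and endpoints, two per trajectory, fewer than [n]. *)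
have t2L : (t.*2.+2 <= L)%N.
  by rewrite (leq_trans _ tL) // -mul2n mulnC -[_.+2]add2n leq_add // leq_mul.
have [||v vz v_s] := notin_two_spans (X := flatten_pairs z)
  (Y := ends (wsgn w 1) (s (wvar w 1))) ugc.
- by rewrite size_flatten_pairs sizez (leq_trans _ Ln) // ltnW // ltnW.
- rewrite size_map (leq_ltn_trans (sN _).1) // (leq_ltn_trans _ Ln) //.
  by rewrite (leq_trans _ tL) // leq_addl.
have l_gt0 : (0 < l)%N by apply: ltn_trans l2.
have [||||s' [u [s'N u_vz s'P]]] // := extend_trajectory (m := l.-1) (j := 1)
   (X := v :: flatten_pairs z) _ _ _ _ sN v_s.
- by rewrite add1n prednK.
- by rewrite (leq_trans _ tL) // addnC -addSn prednK.
- by rewrite /= size_flatten_pairs sizez (leq_trans _ Ln) // ltnW.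
exists s', ((v, u) :: z); split => /=.
- by rewrite mulSn addnC; rewrite prednK in s'N.
- by rewrite sizez.
- by rewrite /flatten_pairs /= !free_cons u_vz vz.
move=> hs uhs /(s'P _ uhs)[hs_s vu] p; rewrite inE => /predU1P[->|pz] /=.
  by rewrite wevalE !mulmxA -vu mulmxA.
exact: sz.
Qed.

End Words.

(** * The lower bound on the diameter *)

Lemma infimum_nat_le (A : set nat) a : A a -> (infimum 0%N A <= a)%N.
Proof.
move=> Aa; rewrite -leEnat; apply: le_infimum_Nmem => //.
have exA : exists k, `[< A k >] by exists a; apply/asboolP.
have [m /asboolP Am minm] := ex_minnP exA; exists m; split=> [k Ak|k]; last exact.
by rewrite leEnat; apply/minm/asboolP.
Qed.

Lemma pdiam_GL_le (K : fieldType) n : (pdiam (@GL K n) <= n)%N.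
Proof.
have [|[g [h [_ _ ->]]] _] := @pdiamP K n GL; first by exists 1%:M; apply: unitmx1.
by rewrite /pdist; have [[lam _ ->] _] := prankP (invmx g *m h); apply: rank_leq_row.
Qed.

Theorem corollary1 (K : fieldType) (hK : finite_or_complex K) (n r l : nat)
  (w : word K n r l) (hl : (2 <= l)%N) (hw : reduced SL w) :
  (crit_length w)%:R / l%:R - 1 <= (pdiam (word_image SL w))%:R :> rat.
Proof.
have l_gt0 : (0 < l)%N by apply: ltn_trans hl.
(* If the critical length is positive, this is the largest [k] with [k * l] below it; if it is 0, so
   is [k]. Either way it is at most [k.+1 * l]. *)
pose k := ((crit_length w).-1 %/ l)%N.
suff kdiam : (k <= pdiam (word_image SL w))%N.
  rewrite lerBlDr ler_pdivrMr ?ltr0n // natr1 -natrM ler_nat.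
  apply: leq_trans (_ : k.+1 * l <= _)%N; last by rewrite leq_pmul2r.
  by apply: leq_trans (leqSpred _) (ltn_ceil _ l_gt0).
have [-> //|k_gt0] := posnP k.
have crit_gt0 : (0 < crit_length w)%N.
  by rewrite lt0n; apply: contraTneq k_gt0 => c0; rewrite /k c0 div0n.
have kl_crit : (k * l < crit_length w)%N.
  by rewrite -(prednK crit_gt0) ltnS leq_divM.
have crit_n : (crit_length w <= n)%N.
  by apply: leq_trans (pdiam_GL_le K n); apply: infimum_nat_le; left.
pose id_hs (i : 'I_r) : 'M[K]_n := 1%:M.
have id_SL i : SL (id_hs i) by rewrite /SL /= det1.
have id_unit i : id_hs i \in unitmx by apply: unitmx1.
have ug : invmx (weval w id_hs) \in unitmx by rewrite unitmx_inv weval_unit.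
have kl_prank j : Jminus w j -> (k * l < prank (wcoef w j))%N.
  by move=> Jj; apply: leq_trans kl_crit _; apply: infimum_nat_le; right; exists j.
have kl_n := leq_trans kl_crit crit_n.
have [s [z [sN sizez freez zP]]] :=
  independent_trajectories kl_n kl_prank ug hl (leqnn (k * l)).
have [hs hsSL hs_s] := SL_solution sN kl_n.
have hs_unit i : hs i \in unitmx by rewrite unitmxE hsSL unitr1.
have [|_ diam_max] := @pdiamP K n (word_image SL w).
  by exists (weval w id_hs), id_hs.
apply: leq_trans (diam_max (weval w id_hs) (weval w hs) _ _); last 2 first.
- by exists id_hs.
- by exists hs.
rewrite /pdist; have [[lam _ ->] _] := prankP (invmx (weval w id_hs) *m weval w hs).
rewrite -sizez -(size_map (fun p => p.2 - lam *: p.1)).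
apply: rank_ge_free; first exact: free_sub_scale.
(* [p.2 - lam *: p.1] is the image of [p.1] under the matrix whose rank is bounded, hence lies in
   its row space. *)
move=> _ /mapP[p pz ->]; rewrite -(zP _ hs_unit hs_s _ pz) -mul_mx_scalar -mulmxBr.
exact: submxMl.
Qed.
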